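(* Let $\Delta\ge3$, $0\le C\le\Delta-2$ and let $\alpha$ be an integer with $1\le\alpha\le\frac{\Delta-C}{2}$. For every $n$ there exists a graph $G$ with $n$ vertices, maximum degree at most $\Delta$, and arboricity in $[\frac{\alpha+1}{2},\alpha]$, which is properly $(\Delta+C)$-edge colored except for one uncolored edge $e$, with the following property. If $\alpha<\frac{\Delta}{2}$, then every extension of the coloring to a proper $(\Delta+C)$-edge coloring of all of $G$ recolors $$\Omega\!\left(\log_{(\Delta/\alpha-1)}\!\Big(\frac{n(\beta-1)}{\Delta}\Big)\right)$$ edges, where $\beta=\frac{(\Delta-\alpha)(C+\alpha)}{\alpha^2}$; and if $\alpha=\frac{\Delta}{2}$, every such extension recolors $\Omega(n/\Delta)$ edges.
   Context: The arboricity of a graph is the minimum number of forests into which its edge set can be partitioned. A proper edge coloring assigns colors to edges so that edges sharing an endpoint receive distinct colors. The number of recolored edges in an extension is the number of edges other than $e$ whose color differs from the given partial coloring.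
   Formalization: ''For every n'' is replaced by ''for every n ≥ 2Δ'': for small n the claim is false (n ≤ 1 has no edge e; for α = Δ/2 no recoloring can be forced when n is below about Δ/2). The Ω constant is absolute. *)

(* Defs.v *)
From HB Require Import structures.
From mathcomp Require Import all_boot all_order all_algebra.
From mathcomp Require Import reals exp.

Set Implicit Arguments.
Unset Strict Implicit.
Unset Printing Implicit Defensive.

Import Order.TTheory GRing.Theory Num.Theory.

Record sgraph (V : finType) := SGraph {
  adj : rel V;
  adj_sym : symmetric adj;
  adj_irrefl : irreflexive adj }.

Definition edges (V : finType) (G : sgraph V) : {set {set V}} :=
  [set E | [exists x, exists y, adj G x y && (E == [set x; y])]].

Definition degree (V : finType) (G : sgraph V) (x : V) : nat :=
  #|[set y | adj G x y]|.

Definition max_degree (V : finType) (G : sgraph V) : nat :=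
  \max_(x : V) degree G x.

(* A cycle is a duplicate-free cyclic sequence of at least three vertices, so
   traversing one edge back and forth is not a cycle. *)
Definition is_forest (V : finType) (F : {set {set V}}) : Prop :=
  forall s : seq V, (2 < size s)%N ->
    ~ ucycle (fun x y : V => [set x; y] \in F) s.

(* Some of the k forests may be empty; this does not affect the minimum. *)
Definition forest_decomposition (V : finType) (G : sgraph V) (k : nat)
    (F : 'I_k -> {set {set V}}) : Prop :=
  [/\ \bigcup_i F i = edges G,
      forall i j, i != j -> [disjoint F i & F j]
    & forall i, is_forest (F i)].

Definition is_arboricity (V : finType) (G : sgraph V) (a : nat) : Prop :=
  (exists F : 'I_a -> {set {set V}}, forest_decomposition G F) /\
  (forall k (F : 'I_k -> {set {set V}}), forest_decomposition G F ->
     (a <= k)%N).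

(* Colorings are total functions; only their values on D are meaningful. *)
Definition proper_edge_coloring (V : finType) (k : nat) (D : {set {set V}})
    (phi : {set V} -> 'I_k) : Prop :=
  forall E F, E \in D -> F \in D -> E != F -> E :&: F != set0 ->
    phi E != phi F.

(* phi is a coloring of all the edges of G but e. *)
Definition recolored (V : finType) (k : nat) (G : sgraph V) (e : {set V})
    (phi psi : {set V} -> 'I_k) : {set {set V}} :=
  [set E in edges G :\ e | psi E != phi E].

Local Open Scope ring_scope.

Definition logb (R : realType) (b x : R) : R := ln x / ln b.

Definition beta (R : realType) (Delta C alpha : nat) : R :=
  (Delta%:R - alpha%:R) * (C%:R + alpha%:R) / alpha%:R ^+ 2.

(* Main.v *)
(* Split the colors into a set S of Delta - alpha and a set T of C + alpha colors and arrange the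
   vertices in layers, all edges joining consecutive layers. Every vertex of an even (odd) layer
   sends upward one edge of each color of S (of T) and has at most alpha edges downward, so
   the layers need only grow by the factors (Delta - alpha) / alpha and (C + alpha) / alpha in turn,
   hence by beta every two layers. Labelling the edges down from each vertex by [0, alpha) gives
   alpha forests, and the two lowest layers contain K_{alpha,alpha}, which is too dense for alpha / 2
   forests. Below any layer d, a color of S (of T) occurs at most once at each vertex of an even
   (odd) layer, and the coloring attains this bound; so if the edges leaving layer d keep their
   colors there is no color left for e. Hence edges are recolored in every gap between layers. *)

Require Import Defs.
From HB Require Import structures.
From mathcomp Require Import all_boot all_order all_algebra.
From mathcomp Require Import reals exp.
From mathcomp Require boolp.
From mathcomp Require Import zify ring lra.

Set Implicit Arguments.
Unset Strict Implicit.
Unset Printing Implicit Defensive.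

Import Order.TTheory GRing.Theory Num.Theory.
Local Open Scope ring_scope.

(** * Forests and arboricity *)

(** A vertex of maximal layer on a cycle is the upper end of both cycle edges at it, so its two
    neighbors on the cycle would both be its parent, contradicting distinctness. *)
Lemma parent_forest (V : finType) (F : {set {set V}}) (lay : V -> nat) (f : V -> V) :
  (forall E, E \in F -> exists2 y, E = [set f y; y] & (lay (f y) < lay y)%N) ->
  is_forest F.
Proof.
move=> HF s s_gt2 /andP[cyc_s uniq_s].
have [y0 y0s] : exists y0, y0 \in s by case: s s_gt2 {cyc_s uniq_s} => // a s _; exists a; rewrite inE eqxx.
case: (@arg_maxnP _ y0 (mem s) lay y0s) => y ys ymax.
have parent z : z \in s -> [set y; z] \in F -> z = f y.
  move=> zs /HF[w eqE lt_w].
  have fww : (f w == w) = false by apply/eqP => e; rewrite e ltnn in lt_w.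
  have : y \in [set f w; w] by rewrite -eqE !inE eqxx.
  rewrite !inE => /orP[/eqP ey|/eqP ey].
    have : w \in [set y; z] by rewrite eqE !inE eqxx orbT.
    rewrite !inE ey eq_sym fww /= => /eqP ez.
    by have := ymax z zs; rewrite /= ey -ez leqNgt lt_w.
  have : f w \in [set y; z] by rewrite eqE !inE eqxx.
  by rewrite !inE ey fww /= => /eqP.
case: (rot_to ys) => i s' eq_s'.
have : cycle (fun x z : V => [set x; z] \in F) (rot i s) by rewrite rot_cycle.
have : uniq (rot i s) by rewrite rot_uniq.
have : (2 < size (rot i s))%N by rewrite size_rot.
have sub z : z \in rot i s -> z \in s by rewrite mem_rot.
move: sub; rewrite eq_s'.
case: s' eq_s' => [|z s'] // _; case: (lastP s') => // s0 z' sub _.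
rewrite /= !mem_rcons inE negb_or rcons_path last_rcons => /andP[_ /andP[/andP[nzz' _] _]].
case/andP=> yz /andP[_ z'y].
have e1 : z = f y by apply: parent => //; apply: sub; rewrite !inE eqxx orbT.
have e2 : z' = f y.
  by apply: parent; [apply: sub; rewrite !inE mem_rcons inE eqxx !orbT | rewrite setUC].
by rewrite e1 e2 eqxx in nzz'.
Qed.

(** [is_forest] does not constrain members of [F] that are not pairs, so only two-element sets are
    counted. *)
Definition inner (V : finType) (F : {set {set V}}) (W : {set V}) : {set {set V}} :=
  [set E in F | (E \subset W) && (#|E| == 2)].

(** Otherwise a path inside [W] can always leave its first vertex by an edge other than the one it
    came by. As it cannot close into a cycle it would outgrow [W]. *)
Lemma forest_leaf (V : finType) (F : {set {set V}}) (W : {set V}) :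
  is_forest F -> W != set0 ->
  exists2 x, x \in W & (#|[set E in inner F W | x \in E]| <= 1)%N.
Proof.
move=> forF /set0Pn[x0 x0W].
case: (boolP [exists x in W, (#|[set E in inner F W | x \in E]| <= 1)%N]) => [/existsP[x /andP[xW ?]]|].
  by exists x.
rewrite negb_exists => /forallP noleaf; exfalso.
have nbr x z : x \in W -> exists y, [/\ y \in W, y != z, y != x & [set x; y] \in F].
  move=> xW; have := noleaf x; rewrite xW /= -ltnNge => /card_gt1P[E1 [E2 []]].
  have other E : E \in [set E in inner F W | x \in E] ->
      exists y, [/\ y \in W, y != x, E = [set x; y] & E \in F].
    rewrite !inE => /andP[/and3P[EF EW /cards2P[a [b [ab eqE]]]]]; rewrite eqE !inE.
    move: EF EW; rewrite eqE subUset !sub1set => EF /andP[aW bW] /orP[]/eqP exa.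
      by exists b; rewrite exa eq_sym.
    by exists a; rewrite exa setUC; split=> //; rewrite setUC.
  move=> /other[y1 [y1W y1x eq1 F1]] /other[y2 [y2W y2x eq2 F2]] E12.
  case: (eqVneq y1 z) => [e1|ne1]; last by exists y1; rewrite -eq1.
  exists y2; rewrite -eq2; split=> //; apply: contraNneq E12 => e2.
  by rewrite eq1 eq2 e1 e2.
have long n : exists x p, [/\ size p = n, path (fun x y : V => [set x; y] \in F) x p,
    uniq (x :: p) & {subset x :: p <= W}].
  elim: n => [|n [x [p [sp pp up sub]]]].
    by exists x0, [::]; split=> // y; rewrite inE => /eqP->.
  (* The new vertex must avoid the successor of [x] on the path. For the one-vertex path the default
     [x] imposes nothing new. *)
  have [y [yW yz yx xyF]] := nbr x (head x p) (sub _ (mem_head _ _)).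
  case: (boolP (y \in x :: p)) => [|yp].
    rewrite inE (negPf yx) /= => yp; exfalso.
    case/splitPr: yp pp up yz {sub sp} => p1 p2.
    case: p1 => [|z p1]; first by rewrite /= eqxx.
    move=> pp up _; apply: (forF (x :: rcons (z :: p1) y)).
      by rewrite /= size_rcons.
    have eqp : (z :: p1) ++ y :: p2 = rcons (z :: p1) y ++ p2 by rewrite cat_rcons.
    move: pp up; rewrite eqp -cat_cons cat_uniq cat_path => /andP[pp _] /and3P[up _ _].
    by apply/andP; split=> //; rewrite /cycle rcons_path pp last_rcons setUC.
  exists y, (x :: p); split=> //=; first by rewrite sp.
  - by rewrite setUC xyF.
  - by rewrite yp.
  - by move=> w; rewrite inE => /orP[/eqP->|/sub].
have [x [p [sp _ up sub]]] := long #|W|.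
by have := uniq_leq_size up (s2 := enum W) (fun y yp => ltac:(by rewrite mem_enum; apply: sub)); rewrite /= sp -cardE ltnn.
Qed.

(** Removing a vertex of degree at most one loses at most one edge; induct on the size of [W]. *)
Lemma forest_edge_bound (V : finType) (F : {set {set V}}) (W : {set V}) :
  is_forest F -> W != set0 -> (#|inner F W| < #|W|)%N.
Proof.
move=> forF; move: {-2}#|W| (erefl #|W|) => n; elim: n W => [|n IH] W cW W0.
  by move: W0; rewrite -cards_eq0 -cW.
have [x xW dx] := forest_leaf forF W0.
have cW' : #|W :\ x| = n by have := cardsD1 x W; rewrite xW -cW; lia.
have sub : inner F W \subset inner F (W :\ x) :|: [set E in inner F W | x \in E].
  apply/subsetP => E; rewrite !inE => /and3P[-> EW ->]; rewrite EW subsetD1 EW /=.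
  by case: (x \in E).
have := leq_trans (subset_leq_card sub) (leq_card_setU _ _).
case: (eqVneq (W :\ x) set0) => [W'0|W'0].
  have -> : inner F (W :\ x) = set0.
    by apply/setP => E; rewrite !inE W'0 subset0; case: eqP => [->|]; rewrite ?cards0 ?andbF.
  have -> : inner F W = set0.
    apply/setP => E; rewrite !inE; apply/negP => /and3P[_ /subset_leq_card EW /eqP E2].
    by move: EW cW'; rewrite E2 W'0 cards0 => ? ?; lia.
  by rewrite cards0; lia.
have := IH _ (esym cW') W'0; lia.
Qed.

(** The [a ^ 2] edges between [X] and [Y] live on [2 * a] vertices, and each forest holds at most
    [2 * a - 1] of them. *)
Lemma bipartite_arboricity (V : finType) (G : sgraph V) (X Y : {set V}) (a k : nat)
    (F : 'I_k -> {set {set V}}) :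
  (0 < a)%N -> #|X| = a -> #|Y| = a -> [disjoint X & Y] ->
  (forall x y, x \in X -> y \in Y -> adj G x y) ->
  forest_decomposition G F -> (a < 2 * k)%N.
Proof.
move=> a0 cX cY dXY XY [covF _ forF].
have W0 : X :|: Y != set0 by rewrite -card_gt0 cardsU; move: dXY; rewrite -setI_eq0 => /eqP->; rewrite cards0; lia.
have cW : #|X :|: Y| = (a + a)%N.
  by rewrite cardsU cX cY; move: dXY; rewrite -setI_eq0 => /eqP->; rewrite cards0 subn0.
pose f (q : V * V) := [set q.1; q.2].
have nin x : x \in X -> x \in Y = false.
  by move=> xX; apply/negbTE; move: dXY => /disjoint_setI0 /setP/(_ x); rewrite !inE xX /= => ->.
have injf : {in setX X Y &, injective f}.
  move=> [x y] [x' y'] /setXP[xX yY] /setXP[x'X y'Y] eqf.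
  have : x \in f (x', y') by rewrite -eqf !inE eqxx.
  have : y \in f (x', y') by rewrite -eqf !inE eqxx orbT.
  rewrite !inE /= => /orP[]/eqP e1 /orP[]/eqP e2; rewrite ?e1 ?e2 //.
  - by move: yY; rewrite e1 nin.
  - by move: yY; rewrite e1 nin.
  - by move: xX => /nin; rewrite e2 y'Y.
have sub : f @: setX X Y \subset \bigcup_i inner (F i) (X :|: Y).
  apply/subsetP => E /imsetP[[x y] /setXP[/= xX yY] ->].
  have : f (x, y) \in edges G.
    by rewrite inE; apply/existsP; exists x; apply/existsP; exists y; rewrite XY ?eqxx.
  rewrite -covF => /bigcupP[i _ Fi]; apply/bigcupP; exists i => //.
  rewrite inE Fi subUset !sub1set !inE xX yY orbT /= cards2.
  by have -> : x != y by apply: contraTneq yY => <-; rewrite nin.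
have := subset_leq_card sub; rewrite card_in_imset // cardsX cX cY.
have le : (#|\bigcup_i inner (F i) (X :|: Y)| <= \sum_(i < k) (a + a).-1)%N.
  elim/big_ind2: _ => [|A1 n1 A2 n2 h1 h2|i _]; first by rewrite cards0.
    exact: leq_trans (leq_card_setU _ _) (leq_add h1 h2).
  by have := forest_edge_bound (forF i) W0; rewrite cW; lia.
move=> /leq_trans/(_ le); rewrite sum_nat_const card_ord => h.
rewrite ltnNge; apply/negP => h2; nia.
Qed.

(** * Layered graphs *)

(* The edge [e] joins [ebot] to [etop]; it has the label [elab] and no color. Every other
   edge is [up x t], colored [t]; the labels lab x t tell apart the edges going down from a vertex. *)
Record layering (V : finType) (k a : nat) := Layering {
  lay : V -> nat;
  side : pred 'I_k;
  up : V -> 'I_k -> option V;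
  lab : V -> 'I_k -> 'I_a;
  ebot : V;
  etop : V;
  elab : 'I_a;
  up_lay : forall x t y, up x t = Some y -> lay y = (lay x).+1;
  up_side : forall x t y, up x t = Some y -> side t = odd (lay x);
  up_injc : forall x t t' y, up x t = Some y -> up x t' = Some y -> t = t';
  up_injv : forall x x' t y, up x t = Some y -> up x' t = Some y -> x = x';
  lab_inj : forall x x' t t' y, up x t = Some y -> up x' t' = Some y ->
    lab x t = lab x' t' -> x = x';
  lay_ebot : lay ebot = 0%N;
  lay_etop : lay etop = 1%N;
  up_etop : forall x t, up x t <> Some etop;
  ebot_full : forall t, ~~ side t -> up ebot t;
  etop_full : forall t, side t -> up etop t }.

Definition below (V : finType) k a (L : layering V k a) (x y : V) : bool :=
  [exists t, up L x t == Some y] || (x == ebot L) && (y == etop L).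

Lemma belowP (V : finType) k a (L : layering V k a) x y :
  reflect ((exists t, up L x t = Some y) \/ (x = ebot L /\ y = etop L)) (below L x y).
Proof.
apply: (iffP orP) => -[H|H].
- by left; case/existsP: H => t /eqP; exists t.
- by right; case/andP: H => /eqP-> /eqP->.
- by left; case: H => t /eqP H; apply/existsP; exists t.
- by right; case: H => -> ->; rewrite !eqxx.
Qed.

Lemma below_lay (V : finType) k a (L : layering V k a) x y :
  below L x y -> lay L y = (lay L x).+1.
Proof. by case/belowP => [[t /up_lay]|[-> ->]] //; rewrite lay_ebot lay_etop. Qed.

Lemma up_below (V : finType) k a (L : layering V k a) x t y :
  up L x t = Some y -> below L x y.
Proof. by move=> H; apply/belowP; left; exists t. Qed.

Lemma set2_lay_inj (V : finType) k a (L : layering V k a) x y x' y' :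
  lay L y = (lay L x).+1 -> lay L y' = (lay L x').+1 ->
  [set x; y] = [set x'; y'] -> x = x' /\ y = y'.
Proof.
move=> l l' E.
have : x \in [set x'; y'] by rewrite -E !inE eqxx.
have : y \in [set x'; y'] by rewrite -E !inE eqxx orbT.
have : x' \in [set x; y] by rewrite E !inE eqxx.
rewrite !inE => /orP[]/eqP e1 /orP[]/eqP e2 /orP[]/eqP e3; move: l l'; rewrite ?e1 ?e2 ?e3; try lia.
all: by move=> l l'; split => //; subst; lia.
Qed.

(** * The graph of a layering: degrees, forests and partial coloring *)

Definition layered_adj (V : finType) k a (L : layering V k a) : rel V :=
  fun x y => below L x y || below L y x.

Lemma layered_adj_sym (V : finType) k a (L : layering V k a) : symmetric (layered_adj L).
Proof. by move=> x y; rewrite /layered_adj orbC. Qed.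

Lemma layered_adj_irrefl (V : finType) k a (L : layering V k a) :
  irreflexive (layered_adj L).
Proof. by move=> x; rewrite /layered_adj orbb; apply/negP => /below_lay; lia. Qed.

Definition layered_graph (V : finType) k a (L : layering V k a) : sgraph V :=
  SGraph (layered_adj_sym L) (layered_adj_irrefl L).

Lemma layered_edgesP (V : finType) k a (L : layering V k a) E :
  reflect (exists x y, below L x y /\ E = [set x; y]) (E \in edges (layered_graph L)).
Proof.
rewrite inE; apply: (iffP existsP) => [[x /existsP[y /andP[/orP[H|H] /eqP->]]]|[x [y [H ->]]]].
- by exists x, y.
- by exists y, x; rewrite setUC.
- by exists x; apply/existsP; exists y; rewrite /= /layered_adj H eqxx.
Qed.

Lemma below_edge (V : finType) k a (L : layering V k a) x y :
  below L x y -> [set x; y] \in edges (layered_graph L).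
Proof. by move=> H; apply/layered_edgesP; exists x, y. Qed.

Definition label (V : finType) k a (L : layering V k a) (x y : V) : 'I_a :=
  if [pick t | up L x t == Some y] is Some t then lab L x t else elab L.

Lemma label_inj (V : finType) k a (L : layering V k a) x x' y :
  below L x y -> below L x' y -> label L x y = label L x' y -> x = x'.
Proof.
case/belowP => [[t H]|[-> ->]]; case/belowP => [[t' H']|[e1 e2]] //.
- rewrite /label; case: pickP => [s /eqP Hs|/(_ t)]; last by rewrite H eqxx.
  case: pickP => [s' /eqP Hs'|/(_ t')]; last by rewrite H' eqxx.
  exact: lab_inj Hs Hs'.
- by case: (@up_etop _ _ _ L x t); rewrite -e2.
- by case: (@up_etop _ _ _ L x' t').
Qed.

(** Downward edges at a vertex have distinct labels, hence number at most [a]; upward colored edges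
    have distinct colors of one side. Only [ebot] has the extra upward edge [e], and it has no
    downward edges while [a] is positive. *)
Lemma layered_degree (V : finType) k a (L : layering V k a) (D : nat) :
  (forall b, #|[pred t | side L t == b]| + a <= D)%N ->
  (max_degree (layered_graph L) <= D)%N.
Proof.
move=> HD; apply/bigmax_leqP => x _.
have a0 : (0 < a)%N by apply: leq_ltn_trans (ltn_ord (elab L)).
pose P := [set y | below L y x]; pose Q := [set y | below L x y].
have nbr : (degree (layered_graph L) x <= #|P| + #|Q|)%N.
  apply: leq_trans (leq_card_setU P Q); apply: subset_leq_card.
  by apply/subsetP => y; rewrite !inE /= /layered_adj orbC.
have cP : (#|P| <= a)%N.
  have inj : {in P &, injective (fun y => label L y x)}.
    by move=> y y'; rewrite !inE => H H'; apply: label_inj.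
  rewrite -(card_in_imset inj); apply: leq_trans (max_card _) _; by rewrite card_ord.
pose U := [set y | [exists t, up L x t == Some y]].
have cU : (#|U| <= #|[pred t | side L t == odd (lay L x)]|)%N.
  pose f t := odflt x (up L x t).
  apply: leq_trans (leq_imset_card f _); apply: subset_leq_card.
  apply/subsetP => y; rewrite inE => /existsP[t /eqP H]; apply/imsetP; exists t.
    by rewrite inE (up_side H).
  by rewrite /f H.
have := HD (odd (lay L x)).
case: (eqVneq x (ebot L)) => [xt|xt]; last first.
  have QU : Q = U.
    by apply/setP => y; rewrite !inE /below (negPf xt) orbF.
  by rewrite QU in nbr; lia.
have P0 : P = set0.
  by apply/setP => y; rewrite !inE; apply/negP => /below_lay; rewrite xt lay_ebot.
have : (#|Q| <= #|U| + 1)%N.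
  rewrite -(cards1 (etop L)); apply: leq_trans (leq_card_setU _ _).
  apply: subset_leq_card; apply/subsetP => y; rewrite !inE => /orP[->//|/andP[_ ->]].
  by rewrite orbT.
by rewrite P0 cards0 in nbr; lia.
Qed.

Definition label_class (V : finType) k a (L : layering V k a) (l : 'I_a) : {set {set V}} :=
  [set E | [exists x, exists y, [&& below L x y, label L x y == l & E == [set x; y]]]].

(** Within one label class a vertex has at most one downward edge, whose lower end serves as its
    parent. *)
Lemma layered_forests (V : finType) k a (L : layering V k a) :
  forest_decomposition (layered_graph L) (label_class L).
Proof.
have classP l E : reflect (exists x y, [/\ below L x y, label L x y = l & E = [set x; y]])
    (E \in label_class L l).
  rewrite inE; apply: (iffP existsP) => [[x /existsP[y /and3P[? /eqP ? /eqP ?]]]|[x [y [H <- ->]]]].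
    by exists x, y.
  by exists x; apply/existsP; exists y; rewrite H !eqxx.
split.
- apply/setP => E; apply/bigcupP/layered_edgesP => [[l _ /classP[x [y [H _ ->]]]]|[x [y [H ->]]]].
    by exists x, y.
  by exists (label L x y) => //; apply/classP; exists x, y.
- move=> l l' ll'; rewrite -setI_eq0; apply/eqP/setP => E; rewrite in_set0.
  apply/negP => /setIP[/classP[x [y [H eql ->]]] /classP[x' [y' [H' eql' eqE]]]].
  have [e1 e2] := set2_lay_inj (below_lay H) (below_lay H') eqE.
  by move: ll'; rewrite -eql -eql' e1 e2 eqxx.
- move=> l; apply: (@parent_forest _ _ (lay L)
    (fun y => odflt y [pick x | below L x y && (label L x y == l)])) => E /classP[x [y [H eql ->]]].
  exists y; case: pickP => [z /andP[Hz /eqP eqz]|/(_ x)] /=; rewrite ?H ?eql ?eqxx //.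
  + by rewrite (label_inj H Hz) ?eql.
  + by rewrite (below_lay Hz).
Qed.

(** The color [c] is a filler for [e] and for the sets that are not edges. *)
Definition layered_coloring (V : finType) k a (L : layering V k a) (c : 'I_k) (E : {set V}) : 'I_k :=
  odflt c [pick t | [exists x, exists y, (up L x t == Some y) && (E == [set x; y])]].

Lemma layered_coloringE (V : finType) k a (L : layering V k a) c x t y :
  up L x t = Some y -> layered_coloring L c [set x; y] = t.
Proof.
move=> H; rewrite /layered_coloring; case: pickP => [t' /existsP[x' /existsP[y' /andP[/eqP H' /eqP]]]|].
  move=> /(set2_lay_inj (up_lay H) (up_lay H'))[e1 e2]; subst x' y'.
  exact: up_injc H' H.
by move/(_ t)/existsP; case; exists x; apply/existsP; exists y; rewrite H !eqxx.
Qed.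

Lemma up_uncolored (V : finType) k a (L : layering V k a) x t y :
  up L x t = Some y -> [set x; y] \in edges (layered_graph L) :\ [set ebot L; etop L].
Proof.
move=> H; rewrite in_setD1 (below_edge (up_below H)) andbT.
apply/eqP => /(set2_lay_inj (up_lay H)) [].
  by rewrite lay_ebot lay_etop.
by move=> _ e; apply: (@up_etop _ _ _ L x t); rewrite -e.
Qed.

Lemma colored_edgeP (V : finType) k a (L : layering V k a) E :
  E \in edges (layered_graph L) :\ [set ebot L; etop L] ->
  exists x t y, up L x t = Some y /\ E = [set x; y].
Proof.
rewrite in_setD1 => /andP[nE /layered_edgesP[x [y [/belowP[[t H]|[-> ->]] eqE]]]].
  by exists x, t, y.
by rewrite eqE eqxx in nE.
Qed.

(** The side of a color fixes the parity of the lower layer of its edges, so two edges of the same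
    color cannot meet as upper end of one and lower end of the other. At a common lower or upper
    end, [up] is functional or injective. *)
Lemma layered_coloring_proper (V : finType) k a (L : layering V k a) c :
  proper_edge_coloring (edges (layered_graph L) :\ [set ebot L; etop L]) (layered_coloring L c).
Proof.
move=> E F /colored_edgeP[x [t [y [H ->]]]] /colored_edgeP[x' [t' [y' [H' ->]]]].
rewrite (layered_coloringE _ H) (layered_coloringE _ H') => nEF /set0Pn[z /setIP[zE zF]].
apply: contraNneq nEF => tt'; subst t'.
have := up_side H; have := up_side H'; have := up_lay H; have := up_lay H'.
move: zE zF; rewrite !inE => /orP[]/eqP -> /orP[]/eqP e; subst.
- by move: H'; rewrite H => -[->].
- by move=> -> _ -> /=; case: odd.
- by move=> _ -> -> /=; case: odd.
- by rewrite (up_injv H H').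
Qed.

(** * Lower bounds on the number of recolored edges *)

Section Recoloring.
Context (V : finType) (k a : nat) (L : layering V k a) (c : 'I_k) (psi : {set V} -> 'I_k).
Context (psi_proper : proper_edge_coloring (edges (layered_graph L)) psi).
Let R := recolored (layered_graph L) [set ebot L; etop L] (layered_coloring L c) psi.

Lemma recoloredP x t y : up L x t = Some y -> ([set x; y] \in R) = (psi [set x; y] != t).
Proof. by move=> H; rewrite /R inE (up_uncolored H) (layered_coloringE _ H) eq_sym. Qed.

Lemma same_edge x y x' y' z : below L x y -> below L x' y' -> z \in [set x; y] ->
  z \in [set x'; y'] -> psi [set x; y] = psi [set x'; y'] -> x = x' /\ y = y'.
Proof.
move=> H H' zE zF eqc; apply: (set2_lay_inj (below_lay H) (below_lay H')).
apply/eqP; apply: contraT => nE.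
have := psi_proper (below_edge H) (below_edge H') nE.
rewrite eqc eqxx; apply; apply/set0Pn; exists z; exact/setIP.
Qed.

(** All colors of one side leave [ebot] and all others leave [etop], so the color given to [e] is
    already present at one of its ends. *)
Lemma recolored_gt0 : (0 < #|R|)%N.
Proof.
rewrite card_gt0; apply/negP => /eqP R0.
have keep x t y : up L x t = Some y -> psi [set x; y] = t.
  by move=> H; apply/eqP; have := recoloredP H; rewrite R0 inE => /esym/negbFE.
have e : below L (ebot L) (etop L) by apply/belowP; right.
case: (boolP (side L (psi [set ebot L; etop L]))) => [/etop_full|/ebot_full].
  case H : up => [y|] // _.
  have [] := @same_edge _ _ _ _ (etop L) e (up_below H).
  - by rewrite !inE eqxx orbT.
  - by rewrite !inE eqxx.
  - by rewrite (keep _ _ _ H).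
  by move=> /(congr1 (lay L)); rewrite lay_ebot lay_etop.
case H : up => [y|] // _.
have [] := @same_edge _ _ _ _ (ebot L) e (up_below H).
- by rewrite !inE eqxx.
- by rewrite !inE eqxx.
- by rewrite (keep _ _ _ H).
by move=> _ e2; case: (@up_etop _ _ _ L (ebot L) (psi [set ebot L; etop L])); rewrite {2}e2.
Qed.

(* Each color is used below layer [d] by at most as many edges as there are vertices in the
   layers of its side; the partial coloring attains all these bounds, so there is no room for [e]. *)
Lemma gap_recolored d : (0 < d)%N ->
  (forall z t, (lay L z <= d)%N -> side L t = odd (lay L z) -> up L z t) ->
  exists E, E \in R /\ exists z y, [/\ E = [set z; y], lay L z = d & lay L y = d.+1].
Proof.
move=> d0 full.
case: (boolP [exists z, exists t, exists y, [&& up L z t == Some y, lay L z == d & psi [set z; y] != t]]).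
  case/existsP=> z /existsP[t /existsP[y /and3P[/eqP H /eqP zd ne]]].
  exists [set z; y]; rewrite (recoloredP H) ne; split=> //; exists z, y; split=> //.
  by rewrite (up_lay H) zd.
move=> none; exfalso.
have keep z t y : up L z t = Some y -> lay L z = d -> psi [set z; y] = t.
  move=> H zd; apply: contraNeq none => ne; apply/existsP; exists z; apply/existsP; exists t.
  by apply/existsP; exists y; rewrite H zd ne !eqxx.
(* [A] holds the edges starting below layer [d], including [e]; [P] holds the places for colors at
   the vertices below [d]. The contradiction comes from counting both. *)
pose A := [set q : V * V | below L q.1 q.2 && (lay L q.1 < d)%N].
pose P := [set q : V * 'I_k | (side L q.2 == odd (lay L q.1)) && (lay L q.1 < d)%N].
pose col (q : V * V) := psi [set q.1; q.2].
(* An edge is charged to its end in a layer matching the side of its color. Properness of [psi]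
   makes the charge injective. *)
pose g (q : V * V) := (if side L (col q) == odd (lay L q.1) then q.1 else q.2, col q).
have gend q : (g q).1 \in [set q.1; q.2] by rewrite /g /=; case: ifP; rewrite !inE eqxx ?orbT.
have AP : (#|A| <= #|P|)%N.
  have injg : {in A &, injective g}.
    move=> q q'; rewrite !inE => /andP[H _] /andP[H' _] eqg.
    have [] := same_edge H H' (gend q); first by rewrite eqg gend.
      by case: eqg.
    by case: q q' {H H' eqg} => [x y] [x' y'] /= -> ->.
  rewrite -(card_in_imset injg); apply: subset_leq_card; apply/subsetP => _ /imsetP[q + ->].
  rewrite !inE => /andP[H qd]; rewrite /g /=; case: ifP => [->//|].
  have lq := below_lay H; rewrite lq /= => sq'.
  have sq : side L (col q) = ~~ odd (lay L q.1) by move: sq'; case: side; case: odd.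
  have sq2 : side L (col q) = odd (lay L q.2) by rewrite lq /= sq.
  (* A charge could leave [P] only by landing in layer [d], but there every matching color is held
     by an upward edge that kept it. *)
  rewrite -/(col q) sq eqxx /= ltn_neqAle qd andbT; apply/eqP => ld.
  have := full q.2 (col q); rewrite lq ld leqnn => /(_ isT).
  rewrite -ld -lq sq2 => /(_ erefl); case Hu : up => [y|] // _.
  have [] := @same_edge _ _ _ _ q.2 H (up_below Hu).
  - by rewrite !inE eqxx orbT.
  - by rewrite !inE eqxx.
  - by rewrite (keep _ _ _ Hu) // lq.
  by move=> /(congr1 (lay L)); rewrite lq; lia.
(* Each place in [P] carries its upward edge of the original coloring, and [e] is one edge more. *)
have PA : (#|P| < #|A|)%N.
  pose h (q : V * 'I_k) := (q.1, odflt q.1 (up L q.1 q.2)).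
  have hP q : q \in P -> exists y, up L q.1 q.2 = Some y /\ h q = (q.1, y).
    rewrite inE => /andP[/eqP s1 s2]; have := full q.1 q.2 (ltnW s2) s1.
    by rewrite /h; case: up => [y|] // _; exists y.
  have injh : {in P &, injective h}.
    move=> q q' /hP[y [H ->]] /hP[y' [H' ->]] [e1 e2]; subst y'.
    by move: H'; rewrite -e1 => /(up_injc H) e3; case: q q' e1 e3 {H} => ? ? [? ?] /= -> ->.
  rewrite -(card_in_imset injh).
  have eA : (ebot L, etop L) \in A by rewrite inE lay_ebot d0 andbT; apply/belowP; right.
  rewrite (cardsD1 (ebot L, etop L) A) eA add1n ltnS; apply: subset_leq_card.
  apply/subsetP => _ /imsetP[q qP ->]; have [y [H ->]] := hP q qP.
  rewrite !inE /= (up_below H) /=; move: qP; rewrite inE => /andP[_ ->]; rewrite andbT.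
  by apply/eqP => -[_ e]; apply: (@up_etop _ _ _ L q.1 q.2); rewrite -e.
by rewrite leqNgt PA in AP.
Qed.

(** Each of the gaps above layers 1 to [D - 1] contains a recolored edge, and edges in different
    gaps are different. *)
Lemma recolored_layers D :
  (forall z t, (lay L z < D)%N -> side L t = odd (lay L z) -> up L z t) ->
  (D.-1 <= #|R|)%N.
Proof.
move=> full.
have /fin_all_exists[f fP] (i : 'I_D.-1) : exists E, E \in R /\
    exists z y, [/\ E = [set z; y], lay L z = i.+1 & lay L y = i.+2].
  apply: gap_recolored => // z t zi; apply: full; have := ltn_ord i; lia.
have injf : injective f.
  move=> i j eqf; have [_ [z [y [e1 e2 e3]]]] := fP i; have [_ [z' [y' [e1' e2' e3']]]] := fP j.
  have [e4 _] : z = z' /\ y = y'.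
    by apply: (@set2_lay_inj _ _ _ L); rewrite ?e2 ?e2' -?e1 -?e1'.
  by apply: val_inj; move: e2'; rewrite -e4 e2 => -[].
rewrite -[X in (X <= _)%N]card_ord -cardsT -(card_imset _ injf); apply: subset_leq_card.
by apply/subsetP => _ /imsetP[i _ ->]; case: (fP i).
Qed.
End Recoloring.

(** * Layered graphs with prescribed layer sizes *)

(* The gap between consecutive layers: the vertex [j] sends its edge of color [t] to [gap_end]. The
   values j * p + p - 1 - (t * w mod p) arising at a fixed end are distinct, congruent mod [w]
   and below a * p, so dividing them by [w] gives distinct labels below [alpha]. *)
Definition gap_end (p w j t : nat) : nat := ((j + t * w %/ p) %% w)%N.
Definition gap_label (p w j t : nat) : nat := ((j * p + (p.-1 - (t * w) %% p)) %/ w)%N.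

Lemma modn_inj_window (w x y z : nat) :
  (x < w)%N -> (y < w)%N -> (z + x = z + y %[mod w])%N -> x = y.
Proof. by move=> xw yw /eqP; rewrite eqn_modDl !modn_small // => /eqP. Qed.

(** As [p <= w], the shifts [t * w %/ p] increase strictly with [t] and stay below [w]. *)
Lemma gap_end_injt p w j t t' : (p <= w)%N -> (t < p)%N -> (t' < p)%N ->
  gap_end p w j t = gap_end p w j t' -> t = t'.
Proof.
move=> pw tp t'p.
have p0 : (0 < p)%N by lia.
have lt_w r : (r < p)%N -> (r * w %/ p < w)%N by move=> rp; rewrite ltn_divLR //; nia.
have mono r r' : (r < r')%N -> (r * w %/ p < r' * w %/ p)%N.
  move=> rr'; rewrite leq_divRL // mulSn; have := leq_trunc_div (r * w) p; nia.
move=> /(modn_inj_window (lt_w t tp) (lt_w t' t'p)) e.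
by case: (ltngtP t t') => // /mono; rewrite e ltnn.
Qed.

Lemma gap_end_injj p w j j' t : (j < w)%N -> (j' < w)%N ->
  gap_end p w j t = gap_end p w j' t -> j = j'.
Proof.
by move=> jw j'w; rewrite /gap_end ![(_ + t * w %/ p)%N]addnC => /(modn_inj_window jw j'w).
Qed.

Lemma gap_label_lt p w j t a alpha : (0 < p)%N -> (j < a)%N -> (a * p <= alpha * w)%N ->
  (gap_label p w j t < alpha)%N.
Proof.
move=> p0 ja H; have w0 : (0 < w)%N by case: w H => //; nia.
by rewrite ltn_divLR //; apply: leq_trans H; nia.
Qed.

Lemma gap_label_inj p w j j' t t' : (0 < p)%N ->
  gap_end p w j t = gap_end p w j' t' -> gap_label p w j t = gap_label p w j' t' -> j = j'.
Proof.
move=> p0; rewrite /gap_label.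
have small q : (p.-1 - q < p)%N by lia.
(* Adding a multiple of [w] restores the subtracted remainder, so modulo [w] the labeled value
   depends only on the end. With the quotient by [w] equal too, the values agree, and division by
   [p] recovers [j]. *)
have key i r : (i * p + (p.-1 - (r * w) %% p) + r * w = (i + r * w %/ p) * p + p.-1)%N.
  by have := divn_eq (r * w) p; have := ltn_pmod (r * w) p0; nia.
set x := (j * p + _)%N; set x' := (j' * p + _)%N => eqe eqd.
have kx : (x = gap_end p w j t * p + p.-1 %[mod w])%N.
  by rewrite -[LHS](modnMDl t) addnC key -[in RHS]modnDml -[in RHS]modnMml modn_mod modnMml modnDml.
have kx' : (x' = gap_end p w j' t' * p + p.-1 %[mod w])%N.
  by rewrite -[LHS](modnMDl t') addnC key -[in RHS]modnDml -[in RHS]modnMml modn_mod modnMml modnDml.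
have : x = x' by rewrite (divn_eq x w) (divn_eq x' w) eqd kx kx' eqe.
by rewrite /x /x' => /(congr1 (divn^~ p)); rewrite !divnMDl // !(divn_small (small _)) !addn0.
Qed.

Definition gap_colors (A B i : nat) : nat := if odd i then B else A.

Definition offset (m : nat -> nat) (i : nat) : nat := (\sum_(j < i) m j)%N.

(* Layer [i] has [width i] vertices, numbered from [offset width i]; the first [active i] of them
   have upward edges, with ends among the [room i] vertices numbered from [start i]. *)
Record blueprint (n A B alpha : nat) := Blueprint {
  width : nat -> nat;
  active : nat -> nat;
  start : nat -> nat;
  room : nat -> nat;
  A_gt0 : (0 < A)%N;
  B_gt0 : (0 < B)%N;
  alpha_gt0 : (0 < alpha)%N;
  width_gt0 : forall i, (0 < width i)%N;
  active0 : (0 < active 0)%N;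
  active1 : (0 < active 1)%N;
  active_width : forall i, (active i <= width i)%N;
  active_room : forall i, (0 < active i)%N -> (active i <= room i)%N;
  colors_room : forall i, (0 < active i)%N -> (gap_colors A B i <= room i)%N;
  load_room : forall i, (active i * gap_colors A B i <= alpha * room i)%N;
  start_ge : forall i, (offset width i.+1 <= start i)%N;
  start0 : start 0 = (offset width 1).+1;
  start_room : forall i, (0 < active i)%N -> (start i + room i <= offset width i.+2)%N;
  start_room_n : forall i, (0 < active i)%N -> (start i + room i <= n)%N }.

Lemma offsetS m i : offset m i.+1 = (offset m i + m i)%N.
Proof. by rewrite /offset big_ord_recr. Qed.

Lemma offset_mono m i j : (i <= j)%N -> (offset m i <= offset m j)%N.
Proof.
move=> ij; rewrite -(subnK ij); elim: (j - i)%N => [|k IH]; first by rewrite add0n.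
by rewrite addSn offsetS; lia.
Qed.

Lemma offset_ge m i : (forall i, 0 < m i)%N -> (i <= offset m i)%N.
Proof. by move=> m0; elim: i => // i IH; rewrite offsetS; have := m0 i; lia. Qed.

(** For positive widths [offset m i] is at least [i], so searching the first [x.+1] layers
    suffices. *)
Definition layer_of (m : nat -> nat) (x : nat) : nat :=
  find (fun i => x < offset m i.+1)%N (iota 0 x.+1).

Lemma layer_ofP m x : (forall i, 0 < m i)%N ->
  (offset m (layer_of m x) <= x < offset m (layer_of m x).+1)%N.
Proof.
move=> m0; set P := fun i => (x < offset m i.+1)%N.
have hasP : has P (iota 0 x.+1).
  by apply/hasP; exists x; [rewrite mem_iota; lia | apply: offset_ge].
have := nth_find 0%N hasP; rewrite -/(layer_of m x) => H.
have lt_x : (layer_of m x < x.+1)%N by rewrite -[X in (_ < X)%N](size_iota 0) -has_find.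
rewrite nth_iota // add0n in H; apply/andP; split=> //.
case E : (layer_of m x) => [|i]; first by rewrite /offset big_ord0.
have iE : (i < layer_of m x)%N by rewrite E.
have := before_find 0%N iE; rewrite nth_iota ?(ltn_trans iE) // add0n /P.
by move=> /negbT; rewrite -leqNgt.
Qed.

Lemma layer_of_eq m x i : (forall i, 0 < m i)%N ->
  (offset m i <= x)%N -> (x < offset m i.+1)%N -> layer_of m x = i.
Proof.
move=> m0 l1 l2; have /andP[l3 l4] := layer_ofP x m0.
case: (ltngtP (layer_of m x) i) => // /(offset_mono m); lia.
Qed.

(** * From a blueprint to a layering *)

Section Construction.
Context (n A B alpha k : nat) (b : blueprint n A B alpha) (kAB : k = (A + B)%N).
Let m := width b.
Let layer (x : 'I_n) := layer_of m x.
Let pos (x : 'I_n) := (x - offset m (layer x))%N.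
(** The first [A] colors form the set S and the last [B] form T. *)
Let bside (t : 'I_k) := (A <= t)%N.
Let rank (t : 'I_k) := if (A <= t)%N then (t - A)%N else t.
Let cols (x : 'I_n) := gap_colors A B (layer x).
Let rm (x : 'I_n) := room b (layer x).

Definition bup (x : 'I_n) (t : 'I_k) : option 'I_n :=
  if (bside t == odd (layer x)) && (pos x < active b (layer x))%N then
    insub (start b (layer x) + gap_end (cols x) (rm x) (pos x) (rank t))%N
  else None.

Definition blab (x : 'I_n) (t : 'I_k) : 'I_alpha :=
  insubd (Ordinal (alpha_gt0 b)) (gap_label (cols x) (rm x) (pos x) (rank t)).

Lemma layerP x : (offset m (layer x) <= x < offset m (layer x).+1)%N.
Proof. exact: layer_ofP (width_gt0 b). Qed.

Lemma posE (x : 'I_n) : val x = (offset m (layer x) + pos x)%N.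
Proof. by rewrite /pos; have /andP[/subnKC] := layerP x. Qed.

Lemma rank_lt (x : 'I_n) t : bside t = odd (layer x) -> (rank t < cols x)%N.
Proof.
rewrite /rank /cols /gap_colors /bside => <-; have := ltn_ord t; rewrite {2}kAB; case: ifP => //; lia.
Qed.

Lemma rank_inj t t' : bside t = bside t' -> rank t = rank t' -> t = t'.
Proof.
rewrite /bside /rank => s; rewrite -s; case: ifP => h e; apply: val_inj => //=.
by move: s e; rewrite h => /esym; lia.
Qed.

Lemma cols_gt0 x : (0 < cols x)%N.
Proof. by rewrite /cols /gap_colors; case: ifP => _; [apply: (B_gt0 b)|apply: (A_gt0 b)]. Qed.

Lemma bup_some x t y : bup x t = Some y ->
  [/\ bside t = odd (layer x), (pos x < active b (layer x))%N &
      val y = (start b (layer x) + gap_end (cols x) (rm x) (pos x) (rank t))%N].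
Proof. by rewrite /bup; case: ifP => // /andP[/eqP H1 H2]; case: insubP => // y' _ e [<-]. Qed.

Lemma gap_end_room x t : (pos x < active b (layer x))%N ->
  (gap_end (cols x) (rm x) (pos x) (rank t) < rm x)%N.
Proof.
move=> H; apply: ltn_pmod; rewrite /rm.
have a0 : (0 < active b (layer x))%N by lia.
by have := active_room a0; lia.
Qed.

Lemma bup_isSome x t : bside t = odd (layer x) -> (pos x < active b (layer x))%N -> bup x t.
Proof.
move=> H1 H2; rewrite /bup H1 eqxx H2 insubT //=.
have a0 : (0 < active b (layer x))%N by lia.
by have := start_room_n a0; have := gap_end_room t H2; rewrite /rm; lia.
Qed.

Lemma bup_lay x t y : bup x t = Some y -> layer y = (layer x).+1.
Proof.
case/bup_some => _ H ye; apply: layer_of_eq (width_gt0 b) _ _; rewrite ye.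
  by have := start_ge b (layer x); rewrite /m; lia.
have a0 : (0 < active b (layer x))%N by lia.
by have := start_room a0; have := gap_end_room t H; rewrite /rm /m; lia.
Qed.

Lemma bup_side x t y : bup x t = Some y -> bside t = odd (layer x).
Proof. by case/bup_some. Qed.

Lemma bup_same x t y x' t' : bup x t = Some y -> bup x' t' = Some y ->
  layer x = layer x' /\
  gap_end (cols x) (rm x) (pos x) (rank t) = gap_end (cols x) (rm x) (pos x') (rank t').
Proof.
move=> H H'; have := bup_lay H; rewrite (bup_lay H') => -[e].
have [_ _ y1] := bup_some H; have [_ _ y2] := bup_some H'.
by split=> //; move: y2; rewrite y1 /cols /rm e => /addnI.
Qed.

Lemma bup_injc x t t' y : bup x t = Some y -> bup x t' = Some y -> t = t'.
Proof.
move=> H H'; have [_ e] := bup_same H H'.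
have [s1 a1 _] := bup_some H; have [s2 _ _] := bup_some H'.
apply: rank_inj; first by rewrite s1.
apply: gap_end_injt e; [|exact: rank_lt|exact: rank_lt].
by apply: colors_room; lia.
Qed.

Lemma pos_inj x x' : layer x = layer x' -> pos x = pos x' -> x = x'.
Proof. by move=> e1 e2; apply: val_inj; rewrite !posE e1 e2. Qed.

Lemma bup_injv x x' t y : bup x t = Some y -> bup x' t = Some y -> x = x'.
Proof.
move=> H H'; have [el e] := bup_same H H'.
have [_ a1 _] := bup_some H; have [_ a2 _] := bup_some H'; rewrite -el in a2.
have a0 : (0 < active b (layer x))%N by lia.
have := active_room a0 => a3.
by apply: pos_inj => //; apply: gap_end_injj e; rewrite /rm; lia.
Qed.

Lemma blab_inj x x' t t' y : bup x t = Some y -> bup x' t' = Some y ->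
  blab x t = blab x' t' -> x = x'.
Proof.
move=> H H'; have [el e] := bup_same H H'.
have [_ a1 _] := bup_some H; have [_ a2 _] := bup_some H'.
have ltx z s : (pos z < active b (layer z))%N ->
    (gap_label (cols z) (rm z) (pos z) (rank s) < alpha)%N.
  by move=> az; apply: gap_label_lt (cols_gt0 z) az (load_room b (layer z)).
move/(congr1 val); rewrite /blab /= !val_insubd !ltx // => eql.
apply: pos_inj => //; apply: gap_label_inj (cols_gt0 x) e _.
by rewrite eql /cols /rm el.
Qed.

Lemma offset1_lt_n : (offset m 1 < n)%N.
Proof. by have := start_room_n (active0 b); rewrite (start0 b) /m; lia. Qed.

Let n_gt0 : (0 < n)%N.
Proof. by have := offset1_lt_n; lia. Qed.

Definition bbot : 'I_n := Ordinal n_gt0.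
Definition btop : 'I_n := Ordinal offset1_lt_n.

Lemma layer_bbot : layer bbot = 0%N.
Proof.
apply: layer_of_eq (width_gt0 b) _ _; first by rewrite /offset big_ord0.
by rewrite offsetS /= addn_gt0 (width_gt0 b) orbT.
Qed.

Lemma layer_btop : layer btop = 1%N.
Proof.
by apply: layer_of_eq (width_gt0 b) _ _ => //=; rewrite (offsetS m 1); have := width_gt0 b 1; rewrite /m; lia.
Qed.

(** [start0] skips the first vertex of layer 1, which is kept for [btop]. *)
Lemma bup_btop x t : bup x t <> Some btop.
Proof.
move=> H; have := bup_lay H; rewrite layer_btop => -[e0].
by have [_ _ /=] := bup_some H; rewrite -e0 (start0 b) /m; lia.
Qed.

Lemma bbot_full t : ~~ bside t -> bup bbot t.
Proof.
move=> H; apply: bup_isSome; first by rewrite layer_bbot (negbTE H).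
by rewrite /pos layer_bbot sub0n; apply: (active0 b).
Qed.

Lemma btop_full t : bside t -> bup btop t.
Proof.
move=> H; apply: bup_isSome; first by rewrite layer_btop H.
by rewrite /pos layer_btop subnn; apply: (active1 b).
Qed.

Definition blayering : layering 'I_n k alpha :=
  Layering (Ordinal (alpha_gt0 b)) bup_lay bup_side bup_injc bup_injv blab_inj
    layer_bbot layer_btop bup_btop bbot_full btop_full.

Lemma blayering_full D :
  (forall i, (i < D)%N -> active b i = width b i) ->
  forall z t, (lay blayering z < D)%N -> side blayering t = odd (lay blayering z) ->
  up blayering z t.
Proof.
move=> full z t zD sz; apply: bup_isSome => //.
rewrite full //; have /andP[l1 l2] := layerP z.
by rewrite /pos; move: l2; rewrite (offsetS m (layer z)) -/m; lia.
Qed.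

Lemma blayering_degree D : (A + alpha <= D)%N -> (B + alpha <= D)%N ->
  (max_degree (layered_graph blayering) <= D)%N.
Proof.
move=> AD BD; apply: layered_degree => s /=.
have cB : (#|[pred t | bside t]| <= B)%N.
  have inj : {in [pred t | bside t] &, injective rank}.
    by move=> t t'; rewrite !inE => h h'; apply: rank_inj; rewrite h h'.
  rewrite -(size_image rank) -[B](size_iota 0); apply: uniq_leq_size.
    by apply/dinjectiveP.
  move=> _ /imageP[t + ->]; rewrite inE mem_iota /rank /bside => h; rewrite h.
  by have := ltn_ord t; rewrite {2}kAB; lia.
have cA : (#|[pred t | ~~ bside t]| <= A)%N.
  have inj : {in [pred t | ~~ bside t] &, injective rank}.
    by move=> t t'; rewrite !inE => h h'; apply: rank_inj; rewrite (negbTE h) (negbTE h').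
  rewrite -(size_image rank) -[A](size_iota 0); apply: uniq_leq_size.
    by apply/dinjectiveP.
  move=> _ /imageP[t + ->]; rewrite inE mem_iota /rank /bside => h; rewrite (negbTE h).
  by move: h; rewrite -ltnNge.
case: s.
  have -> : #|[pred t | bside t == true]| = #|[pred t | bside t]|.
    by apply: eq_card => t; rewrite !inE eqb_id.
  by lia.
have -> : #|[pred t | bside t == false]| = #|[pred t | ~~ bside t]|.
  by apply: eq_card => t; rewrite !inE eqbF_neg.
by lia.
Qed.

(** In the lowest gap the numbers of colors and of ends are both [A], so each vertex of layer 0
    reaches all [A] ends. Any [alpha] of these complete a bipartite clique. *)
Lemma blayering_dense (r : nat) (F : 'I_r -> {set {set 'I_n}}) :
  width b 0 = alpha -> active b 0 = alpha -> room b 0 = A -> (alpha <= A)%N ->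
  forest_decomposition (layered_graph blayering) F -> (alpha < 2 * r)%N.
Proof.
move=> w0 a0 r0 aA.
have off1 : offset m 1 = alpha by rewrite /offset big_ord1.
have nA : (alpha.+1 + A <= n)%N.
  by have := start_room_n (active0 b); rewrite (start0 b) r0 -/m off1.
have an : (alpha <= n)%N by lia.
have an' i : (i < alpha)%N -> (alpha.+1 + i < n)%N by lia.
pose fx (i : 'I_alpha) : 'I_n := widen_ord an i.
pose fy (i : 'I_alpha) : 'I_n := Ordinal (an' i (ltn_ord i)).
pose X := fx @: [set: 'I_alpha]; pose Y := fy @: [set: 'I_alpha].
have cX : #|X| = alpha.
  by rewrite card_imset ?cardsT ?card_ord // => i j /(congr1 val) e; apply: val_inj.
have cY : #|Y| = alpha.
  by rewrite card_imset ?cardsT ?card_ord // => i j /(congr1 val) /= e; apply: val_inj => /=; lia.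
apply: bipartite_arboricity (alpha_gt0 b) cX cY _ _.
  rewrite -setI_eq0; apply/eqP/setP => z; rewrite in_set0; apply/negP.
  move=> /setIP[/imsetP[i _ ->] /imsetP[j _ /(congr1 val) /=]]; have := ltn_ord i; lia.
move=> _ _ /imsetP[i _ ->] /imsetP[j _ ->].
have l0 : layer (fx i) = 0%N.
  apply: layer_of_eq (width_gt0 b) _ _; first by rewrite /offset big_ord0.
  by rewrite -/m off1 /= ltn_ord.
have p0 : pos (fx i) = i by rewrite /pos l0 /offset big_ord0 subn0.
have jA : (j < A)%N by have := ltn_ord j; lia.
have iA : (i < A)%N by have := ltn_ord i; lia.
(* With [p = w = A] the end is [i + t] modulo [A]; this color solves for the end [j]. *)
pose t0 := ((j + (A - i)) %% A)%N.
have t0A : (t0 < A)%N by apply: ltn_pmod; apply: (A_gt0 b).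
have t0k : (t0 < k)%N by rewrite kAB; lia.
apply/orP; left; apply: (@up_below _ _ _ _ _ (Ordinal t0k)).
have sd : bside (Ordinal t0k) = odd (layer (fx i)).
  by rewrite l0 /bside /= leqNgt t0A.
have : bup (fx i) (Ordinal t0k) by apply: bup_isSome => //; rewrite l0 p0 a0.
rewrite /=; case H : bup => [y|] // _; congr Some; apply: val_inj.
have [_ _ ->] := bup_some H.
rewrite l0 (start0 b) -/m off1 /=; congr (_ + _)%N.
rewrite p0 /rm l0 r0 /cols l0 /gap_colors /= /rank /= leqNgt t0A /=.
rewrite /gap_end mulnK ?(A_gt0 b) // /t0 modnDmr addnCA subnKC; last by lia.
by rewrite modnDr modn_small.
Qed.
End Construction.

(** * Layer sizes and their growth *)

(* For natural numbers, [alpha < 2 * a] means (alpha + 1) / 2 <= a. *)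
Definition hard_instance (n Delta C alpha D : nat) : Prop :=
  exists G : sgraph 'I_n,
    [/\ (max_degree G <= Delta)%N,
        (exists a : nat, [/\ is_arboricity G a, (alpha < 2 * a)%N & (a <= alpha)%N])
      & exists (e : {set 'I_n}) (phi : {set 'I_n} -> 'I_(Delta + C)),
        [/\ e \in edges G,
            proper_edge_coloring (edges G :\ e) phi
          & forall psi : {set 'I_n} -> 'I_(Delta + C),
            proper_edge_coloring (edges G) psi ->
            (0 < #|recolored G e phi psi|)%N /\ (D.-1 <= #|recolored G e phi psi|)%N]].

Lemma arboricity_exists (V : finType) (G : sgraph V) (a : nat) (F : 'I_a -> {set {set V}}) :
  forest_decomposition G F -> exists2 a', is_arboricity G a' & (a' <= a)%N.
Proof.
elim/ltn_ind: a F => a IH F HF.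
have [[k [F' [HF' ka]]]|no] := boolp.pselect
    (exists k (F' : 'I_k -> {set {set V}}), forest_decomposition G F' /\ (k < a)%N).
  have [a' h1 h2] := IH k ka F' HF'; exists a' => //; lia.
exists a => //; split; first by exists F.
move=> k F' HF'; rewrite leqNgt; apply/negP => ka; apply: no; by exists k, F'.
Qed.

Lemma blueprint_instance (n Delta C alpha D : nat)
    (b : blueprint n (Delta - alpha) (C + alpha) alpha) :
  (2 * alpha + C <= Delta)%N ->
  width b 0 = alpha -> active b 0 = alpha -> room b 0 = (Delta - alpha)%N ->
  (forall i, (i < D)%N -> active b i = width b i) ->
  hard_instance n Delta C alpha D.
Proof.
move=> hD w0 a0 r0 full.
have kAB : (Delta + C)%N = (Delta - alpha + (C + alpha))%N by lia.
have al0 := alpha_gt0 b.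
have k0 : (0 < Delta + C)%N by lia.
pose L := blayering b kAB.
have forests := layered_forests L.
exists (layered_graph L); split.
(* The two degree bounds are [Delta] itself and [C + 2 * alpha]. *)
- by apply: blayering_degree; lia.
- have [a [h1 h2] ha] := arboricity_exists forests.
  exists a; split=> //; have [F HF] := h1.
  by apply: blayering_dense HF => //; lia.
- exists [set ebot L; etop L], (layered_coloring L (Ordinal k0)); split.
  + by apply: below_edge; apply/belowP; right.
  + exact: layered_coloring_proper.
  + move=> psi Hpsi; split; first exact: recolored_gt0.
    by apply: recolored_layers => //; apply: blayering_full.
Qed.

(** This serves bounds that ask for only one recolored edge. Three layers of [alpha], [A.+1] and [B]
    vertices suffice, [etop] alone being active in layer 1; they take
    [Delta + C + alpha + 1 <= 2 * Delta] vertices. *)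
Lemma small_instance (n Delta C alpha : nat) :
  (0 < alpha)%N -> (2 * alpha + C <= Delta)%N -> (2 * Delta <= n)%N ->
  hard_instance n Delta C alpha 1.
Proof.
move=> al0 hD hn.
set A := (Delta - alpha)%N; set B := (C + alpha)%N.
pose w i := if i is i'.+1 then (if i' is i''.+1 then B else A.+1) else alpha.
pose a i := if i is i'.+1 then (if i' is i''.+1 then 0%N else 1%N) else alpha.
pose s i := (offset w i.+1 + (i == 0))%N.
pose r i := if i is i'.+1 then B else A.
have off1 : offset w 1 = alpha by rewrite /offset big_ord1.
have off2 : offset w 2 = (alpha + A.+1)%N by rewrite offsetS off1.
have off3 : offset w 3 = (alpha + A.+1 + B)%N by rewrite offsetS off2.
have b : {b : blueprint n A B alpha | [/\ width b = w, active b = a & room b = r]}.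
  unshelve eexists (@Blueprint n A B alpha w a s r _ _ al0 _ al0 _ _ _ _ _ _ _ _ _) => //.
  - by rewrite /A; lia.
  - by rewrite /B; lia.
  - by case=> [|[|i]] //=; rewrite /B; lia.
  - by case=> [|[|i]].
  - by case=> [|[|i]] //=; rewrite /A /B; lia.
  - by case=> [|[|i]].
  - by case=> [|[|i]] //=; rewrite /gap_colors /=; nia.
  - by move=> i; rewrite /s; lia.
  - by rewrite /s addn1.
  - by case=> [|[|i]] //=; rewrite /s /r ?off1 ?off2 ?off3 /=; lia.
  - by case=> [|[|i]] //=; rewrite /s /r ?off1 ?off2 ?off3 /A /B /=; lia.
case: b => b [ew ea er]; apply: (@blueprint_instance _ _ _ _ _ b) => //.
- by rewrite ew.
- by rewrite ea.
- by rewrite er.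
- by case=> //; rewrite ea ew.
Qed.

(** Layer 1 has one vertex more than [A] for [etop]. Each later width is the least that receives all
    edges from below with at most [alpha] per vertex; [alpha.-1] rounds the quotient up. *)
Fixpoint layer_width (A B alpha i : nat) : nat :=
  if i is i'.+1 then
    if i' is 0%N then A.+1
    else ((layer_width A B alpha i' * gap_colors A B i' + alpha.-1) %/ alpha)%N
  else alpha.

Lemma layer_widthS A B alpha i : (0 < i)%N ->
  layer_width A B alpha i.+1 = ((layer_width A B alpha i * gap_colors A B i + alpha.-1) %/ alpha)%N.
Proof. by case: i. Qed.

Lemma layer_width_ge A B alpha i : (0 < alpha)%N -> (0 < i)%N ->
  (layer_width A B alpha i * gap_colors A B i <= alpha * layer_width A B alpha i.+1)%N.
Proof.
move=> al0 i0; rewrite layer_widthS //.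
by have := ltn_ceil (layer_width A B alpha i * gap_colors A B i + alpha.-1) al0; nia.
Qed.

Lemma layer_width_lt A B alpha i : (0 < alpha)%N -> (0 < i)%N ->
  (alpha * layer_width A B alpha i.+1 <= layer_width A B alpha i * gap_colors A B i + alpha.-1)%N.
Proof. by move=> al0 i0; rewrite layer_widthS // mulnC leq_trunc_div. Qed.

Lemma layer_width_le A B alpha i : (0 < alpha)%N -> (alpha <= A)%N -> (alpha <= B)%N ->
  (layer_width A B alpha i <= layer_width A B alpha i.+1)%N.
Proof.
move=> al0 aA aB; case: (posnP i) => [->|i0]; first by rewrite /=; lia.
rewrite -(leq_pmul2l al0); apply: leq_trans (layer_width_ge A B al0 i0).
by rewrite mulnC leq_mul2l /gap_colors; case: odd; rewrite ?aA ?aB ?orbT.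
Qed.

Lemma alpha_le_layer_width A B alpha i : (0 < alpha)%N -> (alpha <= A)%N -> (alpha <= B)%N ->
  (alpha <= layer_width A B alpha i)%N.
Proof.
move=> al0 aA aB; elim: i => // i IH; apply: leq_trans IH _; exact: layer_width_le.
Qed.

(** Layers 0 to [D - 1] are fully active and layer [D] only receives edges, so [D.+1] layers must
    fit. The other vertices stay isolated. *)
Lemma layered_instance (n Delta C alpha D : nat) :
  (0 < alpha)%N -> (2 * alpha + C <= Delta)%N -> (1 < D)%N ->
  (offset (layer_width (Delta - alpha) (C + alpha) alpha) D.+1 <= n)%N ->
  hard_instance n Delta C alpha D.
Proof.
move=> al0 hD D1 hn.
set A := (Delta - alpha)%N in hn *; set B := (C + alpha)%N in hn *.
have aA : (alpha <= A)%N by rewrite /A; lia.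
have aB : (alpha <= B)%N by rewrite /B; lia.
pose w := layer_width A B alpha.
pose a i := if (i < D)%N then w i else 0%N.
(* The terms [(i == 0)] keep the first vertex of layer 1 for [etop]. *)
pose s i := (offset w i.+1 + (i == 0))%N.
pose r i := (w i.+1 - (i == 0))%N.
have w0 i : (0 < w i)%N by apply: leq_trans al0 (alpha_le_layer_width i al0 aA aB).
have a_lt i : (0 < a i)%N -> (i < D)%N by rewrite /a; case: (ltnP i D).
have ge i : (0 < i)%N -> (w i * gap_colors A B i <= alpha * w i.+1)%N.
  exact: layer_width_ge.
have le i : (w i <= w i.+1)%N by exact: layer_width_le.
have al i : (alpha <= w i)%N by exact: alpha_le_layer_width.
have sr i : (s i + r i = offset w i.+2)%N.
  by rewrite /s /r [RHS]offsetS; have := w0 i.+1; lia.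
have b : {b : blueprint n A B alpha | [/\ width b = w, active b = a & room b = r]}.
  unshelve eexists (@Blueprint n A B alpha w a s r _ _ al0 w0 _ _ _ _ _ _ _ _ _ _) => //.
  - by lia.
  - by lia.
  - by rewrite /a (ltn_trans _ D1).
  - by rewrite /a D1 w0.
  - by move=> i; rewrite /a; case: (ltnP i D).
  - move=> i /a_lt iD; rewrite /a iD /r; case: (posnP i) => [->|i0].
      by rewrite /w /= subn1.
    by rewrite subn0.
  - move=> i /a_lt iD; rewrite /r; case: (posnP i) => [->|i0].
      by rewrite /w /= subn1.
    by rewrite subn0 -(leq_pmul2l al0); apply: leq_trans (ge _ i0); rewrite leq_mul2r al orbT.
  - move=> i; rewrite /a; case: (ltnP i D) => // iD; rewrite /r; case: (posnP i) => [->|i0].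
      by rewrite /w /= subn1.
    by rewrite subn0 ge.
  - by move=> i; rewrite /s; lia.
  - by rewrite /s addn1.
  - by move=> i _; rewrite sr.
  - by move=> i /a_lt iD; rewrite sr; apply: leq_trans (offset_mono _ _) hn.
case: b => b [ew ea er]; apply: (@blueprint_instance _ _ _ _ _ b) => //.
- by rewrite ew.
- by rewrite ea /a (ltn_trans _ D1).
- by rewrite er /r /w /= subn1.
- by move=> i iD; rewrite ea ew /a iD.
Qed.

Lemma offset_const alpha D : (0 < alpha)%N ->
  (offset (layer_width alpha alpha alpha) D <= D * (2 * alpha))%N.
Proof.
move=> al0; have w i : (0 < i)%N -> layer_width alpha alpha alpha i = alpha.+1.
  case: i => // i _; elim: i => // i IH.
  rewrite layer_widthS // IH /gap_colors if_same divnMDl // divn_small; lia.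
elim: D => [|D IH]; first by rewrite /offset big_ord0.
rewrite offsetS; case: (posnP D) => [->|D0]; first by rewrite /offset big_ord0 /=; lia.
by rewrite w //; lia.
Qed.

(** Each even layer is paired with the odd layer above it, which is at least as wide. *)
Lemma offset_odd_layers m J : (forall i, m i <= m i.+1)%N ->
  (offset m (2 * J).+2 <= 2 * \sum_(j < J.+1) m (2 * j).+1)%N.
Proof.
move=> mono; elim: J => [|J IH].
  by rewrite big_ord1 muln0 !offsetS /offset big_ord0; have := mono 0%N; lia.
have -> : (\sum_(j < J.+2) m (2 * j).+1 = \sum_(j < J.+1) m (2 * j).+1 + m (2 * J.+1).+1)%N.
  by rewrite big_ord_recr.
have -> : (2 * J.+1 = (2 * J).+2)%N by lia.
rewrite (offsetS _ (2 * J).+3) (offsetS _ (2 * J).+2).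
by have := mono (2 * J).+2; lia.
Qed.

Lemma layer_width_growth (R : realType) (Delta C alpha j : nat) :
  (0 < alpha)%N -> (2 * alpha + C <= Delta)%N -> (2 * alpha < Delta)%N ->
  (layer_width (Delta - alpha) (C + alpha) alpha (2 * j).+1)%:R <=
    2 * Delta%:R * beta R Delta C alpha ^+ j :> R.
Proof.
move=> al0 hD hlt.
set A := (Delta - alpha)%N; set B := (C + alpha)%N; set w := layer_width A B alpha.
have aA : (alpha < A)%N by rewrite /A; lia.
have aB : (alpha <= B)%N by rewrite /B; lia.
have alR : 0 < alpha%:R :> R by rewrite ltr0n.
have Ed : Delta%:R - alpha%:R = A%:R :> R by rewrite /A natrB //; lia.
have Eb : C%:R + alpha%:R = B%:R :> R by rewrite /B natrD.
have bE : beta R Delta C alpha = A%:R * B%:R / alpha%:R ^+ 2 by rewrite /beta Ed Eb.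
set be := beta R Delta C alpha in bE *.
(* The summand [Delta] strengthens the induction so that it absorbs the rounding up of the
   widths. *)
suff : (w (2 * j).+1)%:R + Delta%:R <= 2 * Delta%:R * be ^+ j :> R.
  by apply: le_trans; rewrite lerDl ler0n.
elim: j => [|j IH].
  by rewrite expr0 mulr1 muln0 -natrD -natrM ler_nat /w /A /=; lia.
have step : (w (2 * j.+1).+1)%:R + Delta%:R <= be * ((w (2 * j).+1)%:R + Delta%:R) :> R.
  rewrite bE mulrAC ler_pdivlMr ?exprn_gt0 //.
  rewrite -natrX -!natrD -!natrM ler_nat.
  have -> : (2 * j.+1 = (2 * j).+2)%N by lia.
  have o1 : gap_colors A B (2 * j).+1 = B by rewrite /gap_colors /= mul2n odd_double.
  have o2 : gap_colors A B (2 * j).+2 = A by rewrite /gap_colors /= mul2n odd_double.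
  have h1 := @layer_width_lt A B alpha (2 * j).+1 al0 isT.
  have h2 := @layer_width_lt A B alpha (2 * j).+2 al0 isT.
  rewrite o1 -/w in h1; rewrite o2 -/w in h2.
  move: (w (2 * j).+1) (w (2 * j).+2) (w (2 * j).+3) h1 h2 => x y z h1 h2.
  have eD : Delta = (A + alpha)%N by rewrite /A; lia.
  rewrite eD.
  have h3 : (alpha * (alpha * z) <= alpha * (y * A + alpha))%N by rewrite leq_mul2l; lia.
  have h4 : (alpha * y * A <= (x * B + alpha) * A)%N by rewrite leq_mul2r; lia.
  (* Rounding over two layers costs at most [alpha * (A + alpha)]. The added [Delta = A + alpha]
     pays for it by this inequality, which rests on [alpha < A]. *)
  have h5 : (alpha * alpha + alpha <= A * B)%N by nia.
  have h6 : ((A + alpha) * (alpha * alpha + alpha) <= (A + alpha) * (A * B))%N by rewrite leq_mul2l h5 orbT.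
  by nia.
apply: le_trans step _.
have be0 : 0 <= be by rewrite bE divr_ge0 ?mulr_ge0 ?ler0n // exprn_ge0 // ler0n.
by apply: le_trans (ler_wpM2l be0 IH) _; rewrite exprS mulrCA.
Qed.

(** A geometric series over the odd layers, with the denominator [beta - 1] cleared. *)
Lemma offset_growth (R : realType) (Delta C alpha J : nat) :
  (0 < alpha)%N -> (2 * alpha + C <= Delta)%N -> (2 * alpha < Delta)%N ->
  (offset (layer_width (Delta - alpha) (C + alpha) alpha) (2 * J).+2)%:R *
    (beta R Delta C alpha - 1) <= 4 * Delta%:R * (beta R Delta C alpha ^+ J.+1 - 1) :> R.
Proof.
move=> al0 hD hlt.
set be := beta R Delta C alpha.
have be1 : 0 <= be - 1.
  rewrite subr_ge0 /be /beta ler_pdivlMr ?exprn_gt0 ?ltr0n // mul1r.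
  rewrite -natrB; last by lia.
  by rewrite -natrD -natrM -natrX ler_nat; nia.
rewrite subrX1 [leRHS]mulrCA [leLHS]mulrC; apply: ler_wpM2l => //.
have aA : (alpha <= Delta - alpha)%N by lia.
have aB : (alpha <= C + alpha)%N by lia.
have := offset_odd_layers J (fun i => layer_width_le i al0 aA aB); rewrite -(ler_nat R) natrM => /le_trans; apply.
have -> : 4 * Delta%:R = 2 * (2 * Delta%:R) :> R by ring.
rewrite -mulrA ler_wpM2l // natr_sum mulr_sumr; apply: ler_sum => j _; exact: layer_width_growth.
Qed.

(** * Comparison of logarithms and choice of the depth *)

Lemma beta_gt1 (R : realType) (Delta C alpha : nat) :
  (0 < alpha)%N -> (2 * alpha + C <= Delta)%N -> (2 * alpha < Delta)%N ->
  1 < beta R Delta C alpha.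
Proof.
move=> al0 hD hlt.
rewrite /beta ltr_pdivlMr ?exprn_gt0 ?ltr0n // mul1r -natrB; last by lia.
by rewrite -natrD -natrM -natrX ltr_nat; nia.
Qed.

(** Since [C + alpha <= Delta - alpha], growth over two layers is at most the square of the base of
    the logarithm; changing base costs a factor 2. *)
Lemma beta_le (R : realType) (Delta C alpha : nat) :
  (0 < alpha)%N -> (2 * alpha + C <= Delta)%N ->
  beta R Delta C alpha <= (Delta%:R / alpha%:R - 1) ^+ 2.
Proof.
move=> al0 hD.
have alR : alpha%:R != 0 :> R by rewrite pnatr_eq0; lia.
have -> : Delta%:R / alpha%:R - 1 = (Delta - alpha)%N%:R / alpha%:R :> R.
  by rewrite natrB; [field | lia].
rewrite expr_div_n /beta ler_pM2r ?invr_gt0 ?exprn_gt0 ?ltr0n // -natrB; last by lia.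
by rewrite -natrD -natrM -natrX ler_nat; nia.
Qed.

(** Bernoulli's inequality twice gives [1 + x <= (1 + x / 4) ^+ 4]. This trades [ln N] for the
    logarithm that determines the depth. *)
Lemma ln_le_4ln1D (R : realType) (x : R) : 0 < x -> ln x <= 4 * ln (1 + x / 4).
Proof.
move=> x0; have y0 : 0 < 1 + x / 4 by lra.
have -> : 4 * ln (1 + x / 4) = ln ((1 + x / 4) ^+ 4) by rewrite lnXn // mulr_natl.
rewrite ler_ln ?posrE ?exprn_gt0 //.
have h1 : 1 + x / 2 <= (1 + x / 4) ^+ 2 by rewrite expr2; nra.
have h2 : 1 + x <= (1 + x / 2) ^+ 2 by rewrite expr2; nra.
have h3 : (1 + x / 2) ^+ 2 <= ((1 + x / 4) ^+ 2) ^+ 2 by rewrite ler_pXn2r ?nnegrE //; lra.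
by rewrite (exprM _ 2 2); lra.
Qed.

Lemma logarithmic_instance (R : realType) (n Delta C alpha : nat) :
  (0 < alpha)%N -> (2 * alpha + C <= Delta)%N -> (2 * alpha < Delta)%N -> (2 * Delta <= n)%N ->
  exists D, hard_instance n Delta C alpha D /\
    forall r : nat, (0 < r)%N -> (D.-1 <= r)%N ->
    logb (Delta%:R / alpha%:R - 1) (n%:R * (beta R Delta C alpha - 1) / Delta%:R) <= 16 * r%:R.
Proof.
have few k r : (k <= 1)%N -> (0 < r)%N -> (8 * k.+1 <= 16 * r)%N by lia.
have many k r : (1 < k)%N -> (2 * k.-1 <= r)%N -> (8 * k.+1 <= 16 * r)%N by lia.
have two k : (1 < k)%N -> (1 < (2 * k.-1).+1)%N by lia.
move=> al0 hD hlt hn.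
have be1 := beta_gt1 R al0 hD hlt.
set N := n%:R * (beta R Delta C alpha - 1) / Delta%:R.
have DR : 0 < Delta%:R :> R by rewrite ltr0n; lia.
have N0 : 0 < N by rewrite /N divr_gt0 ?mulr_gt0 ?subr_gt0 // ltr0n; lia.
have beb := beta_le R al0 hD.
set be := beta R Delta C alpha in be1 N N0 beb *.
set bb := Delta%:R / alpha%:R - 1 in beb *.
have b1 : 1 < bb.
  rewrite /bb ltrBrDr ltr_pdivlMr ?ltr0n // -(natrD R 1 1) -natrM ltr_nat; lia.
have lnb0 : 0 < ln bb by rewrite ln_gt0.
have lnbe0 : 0 < ln be by rewrite ln_gt0.
have lnbe : ln be <= 2 * ln bb.
  have -> : 2 * ln bb = ln (bb ^+ 2) by rewrite lnXn ?mulr_natl //; lra.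
  by rewrite ler_ln // posrE ?exprn_gt0 //; lra.
(* By [offset_growth], [2 * k] layers fit into [n] vertices once [be ^+ k <= X]; [k] is chosen as
   the largest such exponent. *)
set X := 1 + N / 4.
have X1 : 1 < X by rewrite /X; lra.
pose k := Num.truncn (ln X / ln be).
have q0 : 0 <= ln X / ln be by rewrite divr_ge0 ?ln_ge0 // ltW.
have kle : k%:R <= ln X / ln be by rewrite truncn_le.
have klt : ln X / ln be < k.+1%:R by rewrite truncnS_gt.
(* The factor 8 is 4 from [ln_le_4ln1D] times 2 from [lnbe]. *)
have logN : logb bb N <= 8 * k.+1%:R.
  rewrite /logb ler_pdivrMr //.
  have h1 := ln_le_4ln1D N0.
  have h2 : ln X <= k.+1%:R * ln be by rewrite -ler_pdivrMr // ltW.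
  have h3 : k.+1%:R * ln be <= k.+1%:R * (2 * ln bb) by rewrite ler_wpM2l.
  rewrite -/X in h1; lra.
case: (leqP k 1) => k1.
  exists 1%N; split; first exact: small_instance.
  move=> r r0 _; apply: le_trans logN _.
  by rewrite -!natrM ler_nat few.
(* [D = 2 * k - 1], so that [D.+1] is the number [2 * k] of layers that fit. *)
exists (2 * k.-1).+1; split; last first.
  move=> r r0 rk; apply: le_trans logN _.
  by rewrite -!natrM ler_nat many.
apply: layered_instance => //; first exact: two.
rewrite -(ler_nat R) -(@ler_pM2r _ (be - 1)) ?subr_gt0 //.
apply: le_trans (offset_growth R k.-1 al0 hD hlt) _; rewrite -/be.
have bek : be ^+ k <= X.
  rewrite -ler_ln ?posrE ?exprn_gt0 //; [|lra|lra].
  by rewrite lnXn -?[ln be *+ k]mulr_natl -?ler_pdivlMr //; lra.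
rewrite (prednK (ltnW k1)).
have -> : n%:R * (be - 1) = 4 * Delta%:R * (N / 4).
  by rewrite /N; field; rewrite gt_eqF.
by rewrite ler_pM2l ?mulr_gt0 // lerBlDl.
Qed.

(** Both growth factors are 1, so the widths stay bounded by [2 * alpha] and [n %/ (2 * alpha)]
    layers fit. *)
Lemma linear_instance (n alpha : nat) : (0 < alpha)%N -> (2 * (2 * alpha) <= n)%N ->
  exists D, hard_instance n (2 * alpha) 0 alpha D /\
    forall r : nat, (0 < r)%N -> (D.-1 <= r)%N -> (n <= 16 * r * (2 * alpha))%N.
Proof.
move=> al0 hn.
set q := (n %/ (2 * alpha))%N.
have nq : (n < q.+1 * (2 * alpha))%N by apply: ltn_ceil; lia.
have qn : (q * (2 * alpha) <= n)%N by apply: leq_trunc_div.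
case: (leqP q 2) => q2.
  exists 1%N; split; first by apply: small_instance => //; lia.
  by move=> r r0 _; apply: leq_trans (ltnW nq) _; rewrite leq_mul2r; lia.
exists q.-1; split; last first.
  by move=> r r0 rq; apply: leq_trans (ltnW nq) _; rewrite leq_mul2r; lia.
apply: layered_instance; try lia.
have -> : (2 * alpha - alpha = alpha)%N by lia.
by rewrite prednK ?(leq_trans (offset_const _ al0)) //; lia.
Qed.

Theorem mainTheorem3 (R : realType) :
  exists c : R, 0 < c /\
  forall Delta C alpha : nat,
    (3 <= Delta)%N -> (C <= Delta - 2)%N ->
    (1 <= alpha)%N -> alpha%:R <= (Delta%:R - C%:R) / 2 :> R ->
  forall n : nat, (2 * Delta <= n)%N ->
  exists G : sgraph 'I_n,
    [/\ (max_degree G <= Delta)%N,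
        (exists a : nat, [/\ is_arboricity G a,
                            (alpha%:R + 1) / 2 <= a%:R :> R
                          & (a <= alpha)%N])
      & exists (e : {set 'I_n}) (phi : {set 'I_n} -> 'I_(Delta + C)),
        [/\ e \in edges G,
            proper_edge_coloring (edges G :\ e) phi
          & forall psi : {set 'I_n} -> 'I_(Delta + C),
            proper_edge_coloring (edges G) psi ->
            (alpha%:R < Delta%:R / 2 :> R ->
               c * logb (Delta%:R / alpha%:R - 1)
                        (n%:R * (beta R Delta C alpha - 1) / Delta%:R)
               <= #|recolored G e phi psi|%:R) /\
            (alpha%:R = Delta%:R / 2 :> R ->
               c * (n%:R / Delta%:R) <= #|recolored G e phi psi|%:R)]].
Proof.
exists (1 / 16); split; first by lra.
move=> Delta C alpha D3 _ al0 halpha n hn.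
have hD : (2 * alpha + C <= Delta)%N.
  by rewrite -(ler_nat R) natrD natrM; lra.
have [D [inst bounds]] : exists D, hard_instance n Delta C alpha D /\
    forall r : nat, (0 < r)%N -> (D.-1 <= r)%N ->
    (alpha%:R < Delta%:R / 2 :> R -> 1 / 16 * logb (Delta%:R / alpha%:R - 1)
        (n%:R * (beta R Delta C alpha - 1) / Delta%:R) <= r%:R) /\
    (alpha%:R = Delta%:R / 2 :> R -> 1 / 16 * (n%:R / Delta%:R) <= r%:R :> R).
  (* By [hD], either [2 * alpha < Delta], or [Delta = 2 * alpha] and [C = 0]. In each case the other
     implication is vacuous. *)
  have [lt|ge] := ltnP (2 * alpha) Delta.
    have [D [inst H]] := @logarithmic_instance R n Delta C alpha al0 hD lt hn.
    exists D; split=> // r r0 Dr; split=> [_|eqa]; first by have := H r r0 Dr; lra.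
    by move: lt; rewrite -(ltr_nat R) natrM; lra.
  have eD : Delta = (2 * alpha)%N by lia.
  have eC : C = 0%N by lia.
  subst Delta C; have [D [inst H]] := @linear_instance n alpha al0 hn.
  exists D; split=> // r r0 Dr; split=> [|_]; first by rewrite natrM; lra.
  rewrite mulrA ler_pdivrMr ?ltr0n; last by lia.
  by have := H r r0 Dr; rewrite -(ler_nat R) !natrM; lra.
have [G [h1 [a [h2 h3 h4]] [e [phi [h5 h6 h7]]]]] := inst.
exists G; split=> //.
  exists a; split=> //; move: h3; rewrite -(ler_nat R) natrM -natr1; lra.
exists e, phi; split=> // psi /h7[h8 h9]; exact: bounds.
Qed.
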